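(* Let $n$ be a positive integer, let $\alpha<0$ and $\lambda>0$ be real numbers. Then the function $F_\alpha(x_1,\dots,x_n)$ attains a minimum on $H_\lambda$, and $$\min_{(x_1,\dots,x_n)\in H_\lambda} F_\alpha(x_1,\dots,x_n) = \frac{n}{(1+\lambda)^\alpha}.$$
   Context: For a positive integer $n$, a real number $\alpha$ and a real number $\lambda>0$, define $$F_\alpha(x_1,x_2,\dots,x_n)=\sum_{i=1}^{n}\frac{1}{(1+x_i)^\alpha}$$ and $$H_\lambda=\{(x_1,x_2,\dots,x_n)\in\mathbb{R}^n : x_1x_2\cdots x_n=\lambda^n,\ x_1,x_2,\dots,x_n>0\}.$$ *)

(* Defs.v *)
From mathcomp Require Import all_boot all_order all_algebra.
From mathcomp Require Import all_classical all_reals all_analysis.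
Set Implicit Arguments.
Unset Strict Implicit.
Unset Printing Implicit Defensive.
Import Order.TTheory GRing.Theory Num.Theory.
Local Open Scope classical_set_scope.
Local Open Scope ring_scope.

Definition F (R : realType) (n : nat) (alpha : R) (x : 'rV[R]_n) : R :=
  \sum_(i < n) 1 / (1 + x ord0 i) `^ alpha.

Definition H (R : realType) (n : nat) (lambda : R) : set 'rV[R]_n :=
  [set x | \prod_(i < n) x ord0 i = lambda ^+ n /\
       forall i, 0 < x ord0 i].
Arguments H {R} n lambda.

(* [m] belongs to [A] and is a lower bound of [A]: for [A = f @` D], this says
   that [f] attains a minimum on [D] and that its minimum value is [m]. *)
Definition is_minimum (R : realType) (A : set R) (m : R) : Prop :=
  A m /\ lbound A m.

(* Main.v *)
(* The function t |-> (1 + e^t)^(- alpha) is convex, hence lies above its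
   tangent line at t = ln lambda. Summing the tangent inequality over
   t = ln x_i, the linear terms cancel because the x_i have geometric mean
   lambda; equality holds when every x_i is lambda. *)
Require Import Defs.
From mathcomp Require Import all_boot all_order all_algebra.
From mathcomp Require Import all_classical all_reals all_analysis.
From mathcomp Require Import ring.
Import Order.TTheory GRing.Theory Num.Theory.
Local Open Scope classical_set_scope.
Local Open Scope ring_scope.

Lemma ln_sub_le (R : realType) (a b : R) : 0 < a -> 0 < b ->
  ln b - ln a <= b / a - 1.
Proof.
move=> a0 b0; have ba0 : 0 < b / a by rewrite divr_gt0.
rewrite -ln_div ?posrE//.
have := @le_ln1Dx R (b / a - 1); rewrite addrCA subrr addr0.
by apply; rewrite ltrBrDl subrr.
Qed.

Lemma ln_sum (R : realType) (I : Type) (s : seq I) (f : I -> R) :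
  (forall i, 0 < f i) -> ln (\prod_(i <- s) f i) = \sum_(i <- s) ln (f i).
Proof.
move=> f0; rewrite -[RHS]expRK expR_sum; congr ln.
by apply: eq_bigr => i _; rewrite lnK// posrE.
Qed.

(** Tangent line of the convex function t |-> ln (1 + e^t) at t = ln l, where its slope is l / (1 +
    l). *)
Lemma ln1D_tangent (R : realType) (l x : R) : 0 < l -> 0 < x ->
  l / (1 + l) * (ln x - ln l) <= ln (1 + x) - ln (1 + l).
Proof.
move=> l0 x0.
have l1 : 0 < 1 + l by rewrite addr_gt0.
have x1 : 0 < 1 + x by rewrite addr_gt0.
(* With m = (1 + x) / (1 + l), average ln (1 / m) <= 1 / m - 1 and
   ln (x / (l m)) <= x / (l m) - 1 with weights 1 / (1 + l), l / (1 + l). *)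
have A := ln_sub_le _ _ _ x1 l1.
have B := ln_sub_le _ _ _ (mulr_gt0 l0 x1) (mulr_gt0 x0 l1).
rewrite !lnM ?posrE// in B.
have A' := ler_wpM2l (ltW (divr_gt0 ltr01 l1)) A.
have B' := ler_wpM2l (ltW (divr_gt0 l0 l1)) B.
(* The right-hand sides add up to 1 / (1 + x) + x / (1 + x) - 1 = 0. *)
have C := lerD A' B'; rewrite -subr_ge0 in C; rewrite -subr_ge0.
apply: le_trans C _; rewrite le_eqVlt; apply/orP; left; apply/eqP.
by field; rewrite !gt_eqF.
Qed.

(** Once (1 + l)^b is factored out, e^u >= 1 + u bounds the remaining exponential, and
    [ln1D_tangent] scaled by b >= 0 bounds u. *)
Lemma powR1D_tangent (R : realType) (b l x : R) : 0 <= b -> 0 < l -> 0 < x ->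
  (1 + l) `^ b * (1 + b * (l / (1 + l)) * (ln x - ln l)) <= (1 + x) `^ b.
Proof.
move=> b0 l0 x0.
have l1 : 0 < 1 + l by rewrite addr_gt0.
have x1 : 0 < 1 + x by rewrite addr_gt0.
have -> : (1 + x) `^ b = (1 + l) `^ b * expR (b * (ln (1 + x) - ln (1 + l))).
  by rewrite /powR !gt_eqF// -expRD; congr expR; ring.
rewrite ler_wpM2l ?powR_ge0//; apply: le_trans (expR_ge1Dx _).
by rewrite lerD2l -mulrA ler_wpM2l// ln1D_tangent.
Qed.

Theorem proposition3 (R : realType) (n : nat) (alpha lambda : R)
    (n_gt0 : (0 < n)%N) (alpha_lt0 : alpha < 0) (lambda_gt0 : 0 < lambda) :
  is_minimum (F alpha @` H n lambda) (n%:R / (1 + lambda) `^ alpha).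
Proof.
split.
  exists (const_mx lambda).
    split=> [|i]; last by rewrite mxE.
    by under eq_bigr do rewrite mxE; rewrite prodr_const card_ord.
  rewrite /F; under eq_bigr do rewrite mxE.
  by rewrite sumr_const card_ord mul1r mulr_natl.
move=> _ [x [prod_x x_gt0] <-].
have sum_ln : \sum_(i < n) (ln (x ord0 i) - ln lambda) = 0.
  by rewrite sumrB -ln_sum// prod_x lnXn// sumr_const card_ord subrr.
(* Reciprocals become powers with exponent - alpha >= 0, as [powR1D_tangent] requires. *)
rewrite /F -powRN; under eq_bigr do rewrite mul1r -powRN.
set b := - alpha; have b_ge0 : 0 <= b by rewrite oppr_ge0 ltW.
have := @ler_sum R _ (index_enum 'I_n) xpredT _ _
  (fun i _ => powR1D_tangent _ _ _ _ b_ge0 lambda_gt0 (x_gt0 i)).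
apply: le_trans.
(* The slope is the same for every i, so it factors out and multiplies [sum_ln]. *)
rewrite -mulr_sumr big_split/= -mulr_sumr sum_ln mulr0 addr0.
by rewrite sumr_const card_ord mulrC.
Qed.
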